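(* Let $(\mathfrak h,(H_i,L_i)_{i\in I})$ be a linear Coxeter system with linear Coxeter group $\mathcal W$, closed fundamental chamber $\overline C$ and Tits cone $X$. Let $Y\subseteq X$ be a $\mathcal W$-invariant convex subcone containing $0$, and let $R_1\subseteq R_2\subseteq\cdots\subseteq R_m$ be a chain of faces in $\mathrm{Fa}(Y)$. Then there exist a uniquely determined chain $S_1\subseteq S_2\subseteq\cdots\subseteq S_m$ of faces from $\Upsilon$ and an element $\sigma\in\mathcal W$ such that $R_i=\sigma S_i$ for $i=1,2,\dots,m$.
   Context: $\mathbb R^+=(0,\infty)$. A convex cone is a subset of a real vector space closed under addition and under multiplication by elements of $\mathbb R^+$. $\mathrm{ri}$ denotes the relative interior of a finite-dimensional convex set. For a convex cone $K$ containing $0$, a face of $K$ is a convex cone $F\subseteq K$ with $(K\setminus F)+K\subseteq K\setminus F$; $\mathrm{Fa}(K)$ is the set of nonempty faces, ordered by inclusion. Linear Coxeter systems. Let $\mathfrak h$ be a finite-dimensional real vector space, $n\ge1$, $I=\{1,\dots,n\}$. For a zero-based closed ray $H\subseteq\mathfrak h$ put $H^{\ge0}=\{\lambda\in\mathfrak h^*\mid\lambda(h)\ge0\ \forall h\in H\}$, $H^{>0}=\{\lambda\mid\lambda(h)>0\ \forall h\in H\setminus\{0\}\}$, $H^{=0}=\{\lambda\mid\lambda(h)=0\ \forall h\in H\}$. A linear Coxeter system $(\mathfrak h,(H_i,L_i)_{i\in I})$ consists of zero-based closed rays $H_i\subseteq\mathfrak h$, $L_i\subseteq\mathfrak h^*$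 with $L_i\setminus\{0\}\subseteq H_i^{>0}$ such that: (1) the closed fundamental chamber $\overline C=\bigcap_{i\in I}H_i^{\ge0}$ spans $\mathfrak h^*$, and $\overline C\cap H_i^{=0}$, $i\in I$, are its pairwise different faces of codimension 1; (2) with $C=\bigcap_{i\in I}H_i^{>0}$ and $\mathcal W$ (the linear Coxeter group) the group generated by the reflections $\sigma_i$ on $\mathfrak h^*$ at the hyperplane $H_i^{=0}$ along the line $L_i\cup(-L_i)$, one has $\sigma C\cap C=\emptyset$ for all $\sigma\in\mathcal W\setminus\{1\}$. The Tits cone is the convex cone $X=\bigcup_{\sigma\in\mathcal W}\sigma\overline C$. $\Upsilon=\{R\in\mathrm{Fa}(Y)\mid\mathrm{ri}(R)\cap\overline C\ne\emptyset\}$. *)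

(* Defs.v *)
From mathcomp Require Import all_boot all_order all_algebra.
From mathcomp Require Import all_classical reals topology normedtype.

Set Implicit Arguments.
Unset Strict Implicit.
Unset Printing Implicit Defensive.

Import Order.TTheory GRing.Theory Num.Theory VectorInternalTheory.
Import numFieldNormedType.Exports.

Local Open Scope classical_set_scope.
Local Open Scope ring_scope.

Section ConvexSets.
Context {R : realType} {V : vectType R}.
Implicit Types (S K F : set V) (U : {vspace V}).

Definition convex_cone K : Prop :=
  (forall x y, K x -> K y -> K (x + y)) /\
  (forall (t : R) x, 0 < t -> K x -> K (t *: x)).

Definition is_span S U : Prop :=
  (forall x, S x -> x \in U) /\
  (forall U', (forall x, S x -> x \in U') -> (U <= U')%VS).

Definition affine_hull S : set V :=
  [set v | exists (k : nat) (c : 'I_k -> R) (x : 'I_k -> V),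
     [/\ forall i, S (x i), \sum_i c i = 1 & v = \sum_i c i *: x i]].

(* The canonical topology of the finite-dimensional space [V] is that of its
   space of coordinate vectors, along [v2r] and its inverse [r2v]. *)
Definition ri S : set V :=
  [set x | S x /\
     \forall u \near v2r x, affine_hull S (r2v u) -> S (r2v u)].

Definition face K F : Prop :=
  [/\ convex_cone F, F `<=` K &
      [set x + y | x in K `\` F & y in K] `<=` K `\` F].

Definition Fa K : set (set V) := [set F | face K F /\ F !=set0].

(* Only used for faces of cones containing 0; such faces contain 0 as well, so
   their dimension is that of their linear span. *)
Definition codim1 K F : Prop :=
  exists UK UF, [/\ is_span K UK, is_span F UF & \dim UK = (\dim UF).+1].

(* zero-based closed ray *)
Definition closed_ray (D : set V) : Prop :=
  exists2 v : V, v != 0 & D = [set t *: v | t in [set t : R | 0 <= t]].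

(* [s] is the reflection at the hyperplane [P] along the line [D]; this
   determines [s] when V is the direct sum of [P] and [D]. *)
Definition is_reflection (P D : set V) (s : 'End(V)) : Prop :=
  (forall x, P x -> s x = x) /\ (forall x, D x -> s x = - x).

(* For an invertible [f], [(f^-1)%VF] is the two-sided inverse of [f]. *)
Definition lfun_group (G : set 'End(V)) : Prop :=
  [/\ G \1%VF,
      forall f g, G f -> G g -> G (f \o g)%VF &
      forall f, G f -> G (f^-1)%VF].

Definition generated_group (A : set 'End(V)) : set 'End(V) :=
  smallest lfun_group A.

End ConvexSets.

Section LinearCoxeterSystems.
Context {R : realType} {h : vectType R}.

Notation hdual := 'Hom(h, R^o).

Definition ray_ge0 (D : set h) : set hdual :=
  [set l | forall x, D x -> 0 <= l x].

Definition ray_gt0 (D : set h) : set hdual :=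
  [set l | forall x, (D `\ 0) x -> 0 < l x].

Definition ray_eq0 (D : set h) : set hdual :=
  [set l | forall x, D x -> l x = 0].

Section System.
Context {n : nat}.
Variables (H : 'I_n -> set h) (L : 'I_n -> set hdual).

Definition closed_chamber : set hdual := \bigcap_i ray_ge0 (H i).

Definition open_chamber : set hdual := \bigcap_i ray_gt0 (H i).

Definition reflection_at (i : 'I_n) (s : 'End(hdual)) : Prop :=
  is_reflection (ray_eq0 (H i)) (L i `|` [set - l | l in L i]) s.

Definition coxeter_group : set 'End(hdual) :=
  generated_group [set s | exists i, reflection_at i s].

Definition tits_cone : set hdual :=
  \bigcup_(s in coxeter_group) (s @` closed_chamber).

Definition wall (i : 'I_n) : set hdual := closed_chamber `&` ray_eq0 (H i).

Record linear_coxeter_system : Prop := LinearCoxeterSystem {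
  lcs_index : (1 <= n)%N;
  lcs_ray : forall i, closed_ray (H i);
  lcs_coray : forall i, closed_ray (L i);
  lcs_pos : forall i, L i `\ 0 `<=` ray_gt0 (H i);
  lcs_span : is_span closed_chamber fullv;
  lcs_wall_inj : injective wall;
  lcs_walls : range wall =
    [set F | Fa closed_chamber F /\ codim1 closed_chamber F];
  lcs_disj : forall s, coxeter_group s -> s <> \1%VF ->
    (s @` open_chamber) `&` open_chamber = set0 }.

Definition Upsilon (Y : set hdual) : set (set hdual) :=
  [set F | Fa Y F /\ ri F `&` closed_chamber !=set0].

End System.
End LinearCoxeterSystems.

Definition is_chain (T : Type) (m : nat) (F : 'I_m -> set T) : Prop :=
  forall i j : 'I_m, (i <= j)%N -> F i `<=` F j.

(* Main.v *)
(* Reflections in simple walls generate W, and an element is shortened by s_i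
   on the left as soon as it moves the chamber C across the i-th wall: a gallery
   from C to wC then crosses that wall, and disjointness of the chambers lets one
   fold the gallery there.

   Existence: choose successively points z_1, ..., z_k of the closed chamber in
   the relative interiors of the (translated) faces R_1, ..., R_k.  For
   q = z_1 + ... + z_k and y in ri R_{k+1}, some v in the stabilizer of q moves
   q + t y into the closed chamber for small t > 0; as q is a sum of points of
   the closed chamber, v fixes every z_i.

   Uniqueness: let R = w S with both relative interiors meeting the closed
   chamber.  If w C lies behind the i-th wall, then ri R contains points on both
   sides of that wall, hence a point of the wall; so s_i R and R have relative
   interiors with a common point, s_i R = R, and w can be shortened. *)
From HB Require Import structures.
From mathcomp Require Import all_boot all_order all_algebra.
From mathcomp Require Import all_classical reals topology normedtype.
From mathcomp Require Import lra.
Require Import Defs.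

Set Implicit Arguments.
Unset Strict Implicit.
Unset Printing Implicit Defensive.

Import Order.TTheory GRing.Theory Num.Theory VectorInternalTheory.
Import numFieldNormedType.Exports.

Local Open Scope classical_set_scope.
Local Open Scope ring_scope.

Lemma small_perturbation (R : realFieldType) (n : nat) (f g : 'I_n -> R) :
  exists2 t, 0 < t & forall i, 0 < f i -> 0 < f i + t * g i.
Proof.
(* [M] dominates every ratio of [|g i|] to a positive [f i], so one [t] serves all indices; the 1 in
   [1 + M] covers [M = 0]. *)
pose M := \sum_(i | 0 < f i) `|g i| / f i.
have M0 : 0 <= M by apply: sumr_ge0 => i fi; rewrite divr_ge0 // ltW.
have M1 : 0 < 1 + M by lra.
exists (1 + M)^-1; first by rewrite invr_gt0.
move=> i fi.
have gM : `|g i| / f i <= M.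
  by rewrite /M (bigD1 i) //= lerDl; apply: sumr_ge0 => j /andP[fj _];
     rewrite divr_ge0 // ltW.
have gfM : `|g i| < f i * (1 + M) by rewrite mulrC -ltr_pdivrMr //; lra.
rewrite -(pmulr_rgt0 (x := 1 + M)) // mulrDr mulVKf ?gt_eqF // mulrC.
by have := ler_norm (- g i); rewrite normrN; lra.
Qed.

(** * Words in reflections acting on an abstract chamber *)

Section ReflectionWords.
Variables (R : realFieldType) (V : lmodType R) (n : nat).
Variables (a : 'I_n -> {scalar V}) (l : 'I_n -> V).

Definition srefl (i : 'I_n) (x : V) : V := x - a i x *: l i.

Definition word (w : seq 'I_n) (x : V) : V := foldr srefl x w.

Definition in_chamber (x : V) : Prop := forall i, 0 < a i x.
Definition in_cchamber (x : V) : Prop := forall i, 0 <= a i x.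

Lemma srefl_is_linear i : linear (srefl i).
Proof.
move=> t x y; rewrite /srefl linearP /= scalerBr scalerDl scalerA opprD.
by rewrite addrACA.
Qed.
HB.instance Definition _ i := GRing.isLinear.Build R V V _ (srefl i)
  (srefl_is_linear i).

Lemma word_is_linear w : linear (word w).
Proof. by move=> t x y; elim: w => //= i w ->; rewrite linearP. Qed.
HB.instance Definition _ w := GRing.isLinear.Build R V V _ (word w)
  (word_is_linear w).

Lemma word_cat w1 w2 x : word (w1 ++ w2) x = word w1 (word w2 x).
Proof. exact: foldr_cat. Qed.

Lemma word_rcons w i x : word (rcons w i) x = word w (srefl i x).
Proof. by rewrite -cats1 word_cat. Qed.

Lemma wordDZ w x t y : word w (x + t *: y) = word w x + t *: word w y.
Proof. by rewrite addrC linearP addrC. Qed.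

Lemma sreflDZ i x t y : srefl i (x + t *: y) = srefl i x + t *: srefl i y.
Proof. by rewrite addrC linearP addrC. Qed.

Lemma srefl_fixed i x : a i x = 0 -> srefl i x = x.
Proof. by rewrite /srefl => ->; rewrite scale0r subr0. Qed.

Hypothesis al : forall i, a i (l i) = 2.

Lemma root_srefl i x : a i (srefl i x) = - a i x.
Proof. by rewrite /srefl linearB linearZ /= al; lra. Qed.

Lemma sreflK i : involutive (srefl i).
Proof. by move=> x; rewrite {1}/srefl root_srefl scaleNr opprK /srefl subrK. Qed.

Lemma word_revK w : cancel (word w) (word (rev w)).
Proof.
by elim: w => [|i w IH] x //=; rewrite rev_cons word_rcons sreflK IH.
Qed.

Lemma word_revKV w : cancel (word (rev w)) (word w).
Proof. by move=> x; rewrite -{1}(revK w) word_revK. Qed.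

Hypothesis disjoint_chambers : forall w c,
  in_chamber c -> in_chamber (word w c) -> word w =1 id.
Variable c0 : V.
Hypothesis c0_chamber : in_chamber c0.
Variable p : 'I_n -> V.
Hypothesis p_wall : forall j, a j (p j) = 0.
Hypothesis p_pos : forall j k, k != j -> 0 < a k (p j).

(** If [s_i] fixed [word w c], then [w^-1 s_i w] would fix [c] and be the identity by disjointness;
    so would [s_i], although it negates [a i]. *)
Lemma root_word_neq0 i w c : in_chamber c -> a i (word w c) != 0.
Proof.
move=> cC; apply/eqP => /srefl_fixed fixed.
have idw : word (rev w ++ i :: w) =1 id.
  by apply: (disjoint_chambers cC); rewrite word_cat /= fixed word_revK.
have /(congr1 (a i)) : srefl i (l i) = l i.
  have := idw (word (rev w) (l i)).
  by rewrite word_cat /= word_revKV => /(congr1 (word w)); rewrite !word_revKV.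
by rewrite root_srefl al; lra.
Qed.

Lemma word_same_side i w c d : in_chamber c -> in_chamber d ->
  a i (word w c) < 0 -> a i (word w d) < 0.
Proof.
move=> cC dC ci; rewrite ltNge; apply/negP => di.
(* The coefficients put [word w e] on the wall of [a i], while [e] stays in the chamber by
   convexity. *)
pose e := a i (word w d) *: c - a i (word w c) *: d.
have eC : in_chamber e.
  move=> k; rewrite linearB 2!linearZ /=.
  by rewrite ltr_wpDl ?oppr_gt0 ?nmulr_rlt0 // mulr_ge0 // ltW.
have /eqP[] := root_word_neq0 i w eC.
by rewrite linearB 2!linearZ linearB 2!linearZ /=; lra.
Qed.

Lemma word_cchamber_le0 i w c : a i (word w c0) < 0 -> in_cchamber c ->
  a i (word w c) <= 0.
Proof.
move=> ci cC; rewrite leNgt; apply/negP => cpos.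
have [t t0 /(_ _ cpos)] :=
  small_perturbation (fun _ : 'I_1 => a i (word w c))
                     (fun=> a i (word w c0)).
have : in_chamber (c + t *: c0).
  by move=> k; rewrite linearD linearZ /=; have := cC k;
     have := mulr_gt0 t0 (c0_chamber k); lra.
move=> /(word_same_side c0_chamber) /(_ ci).
by rewrite linearD linearZ linearD linearZ /= => h1 /(_ ord0); lra.
Qed.

(** A small step from [p j] in any direction of the hyperplane [a j = 0] stays in the closed
    chamber, so the j-th wall spans this hyperplane. *)
Lemma wall_kernel (b : {scalar V}) j :
  (forall x, in_cchamber x -> a j x = 0 -> b x = 0) ->
  forall x, a j x = 0 -> b x = 0.
Proof.
move=> b0 x ajx.
have [t t0 pt] := small_perturbation (a^~ (p j)) (a^~ x).
have bp : b (p j) = 0.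
  apply: b0 => // k; have [->|/p_pos/ltW //] := eqVneq k j.
  by rewrite p_wall.
have : b (p j + t *: x) = 0.
  apply: b0 => [k|]; rewrite linearD linearZ /=; last first.
    by rewrite p_wall ajx mulr0 addr0.
  have [->|kj] := eqVneq k j; first by rewrite p_wall ajx mulr0 addr0.
  by rewrite ltW // pt // p_pos.
rewrite linearD linearZ /= bp add0r => /eqP.
by rewrite mulf_eq0 gt_eqF //= => /eqP.
Qed.

(* If the chambers [u C] and [u s_j C] lie on opposite sides of the wall of
   [a i], then the wall between them is that wall. Hence near [u (p j)] the
   chambers [s_i u C] and [u s_j C] overlap, so they coincide. *)
Lemma word_cross i u j : 0 < a i (word u c0) -> a i (word (rcons u j) c0) < 0 ->
  forall x, srefl i (word u x) = word u (srefl j x).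
Proof.
move=> upos uneg.
pose b : {scalar V} := a i \o word u.
have bE x : b x = a i (word u x) by [].
have uge0 x : in_cchamber x -> 0 <= b x.
  move=> xC; rewrite leNgt; apply/negP => xneg.
  have [t t0 /(_ ord0)] :=
    small_perturbation (fun _ : 'I_1 => - b x) (fun=> - b c0).
  have /(word_same_side (i := i) (w := u)) /(_ c0_chamber) :
      in_chamber (x + t *: c0).
    by move=> k; rewrite linearD linearZ /=; have := xC k;
       have := mulr_gt0 t0 (c0_chamber k); lra.
  rewrite -!bE linearD linearZ /= -bE in upos *; lra.
(* On the j-th wall [u] and [u s_j] agree, so there [b] is both nonnegative and nonpositive. *)
have b0 x : a j x = 0 -> b x = 0.
  apply: wall_kernel => {}x xC ajx; apply/eqP; rewrite eq_le uge0 // andbT.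
  by have := word_cchamber_le0 uneg xC; rewrite word_rcons srefl_fixed.
pose r := b c0 / a j c0.
have r0 : 0 < r by rewrite divr_gt0.
have br x : b x = r * a j x.
  have : b (x - (a j x / a j c0) *: c0) = 0.
    by apply: b0; rewrite linearB linearZ /= divfK ?gt_eqF // subrr.
  rewrite linearB linearZ /= /r => /eqP; rewrite subr_eq0 => /eqP ->.
  by rewrite mulrAC [RHS]mulrAC (mulrC (b c0)).
(* [c'] lies in [u^-1 s_i u C], across the j-th wall; hence a small step from [p j] in the direction
   of its mirror image [s_j c'] leads into the chamber. *)
pose c' := word (rev u) (srefl i (word u c0)).
have ajc' : a j c' < 0.
  by rewrite -(pmulr_rlt0 (x := r)) // -br bE word_revKV root_srefl oppr_lt0.
have [t t0 pt] := small_perturbation (a^~ (p j)) (a^~ (srefl j c')).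
have dC : in_chamber (p j + t *: srefl j c').
  move=> k; rewrite linearD linearZ /=; have [->|kj] := eqVneq k j.
    by rewrite p_wall add0r pmulr_rgt0 // root_srefl oppr_gt0.
  by rewrite pt // p_pos.
(* This is [u^-1 s_i u s_j]. It carries the point just found to [p j + t *: c0], again in the
   chamber, so it is the identity. *)
pose w := rev u ++ i :: rcons u j.
have eC : in_chamber (p j + t *: c0).
  move=> k; rewrite linearD linearZ /=; have := mulr_gt0 t0 (c0_chamber k).
  have [->|/p_pos] := eqVneq k j; rewrite ?p_wall; lra.
have up_fixed : srefl i (word u (p j)) = word u (p j).
  by apply: srefl_fixed; rewrite -bE br p_wall mulr0.
have wd : word w (p j + t *: srefl j c') = p j + t *: c0.
  rewrite /w word_cat /= word_rcons sreflDZ sreflK (srefl_fixed (p_wall j)).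
  by rewrite (wordDZ u) sreflDZ up_fixed word_revKV sreflK -wordDZ word_revK.
have idw : word w =1 id by apply: (disjoint_chambers dC); rewrite wd.
move=> x; have := idw (srefl j x); rewrite /w word_cat /= word_rcons sreflK.
by move=> /(congr1 (word u)); rewrite word_revKV.
Qed.

(** Letters are stripped from the right until the crossing of the i-th wall happens at the last
    letter [j]; there [s_i u = u s_j], so [s_i] cancels that letter. *)
Lemma word_exchange i w : a i (word w c0) < 0 ->
  exists2 w', (size w' < size w)%N & forall x, srefl i (word w x) = word w' x.
Proof.
elim/last_ind: w => [|u j IH] neg.
  by have := c0_chamber i; move: neg => /=; lra.
rewrite size_rcons; have := root_word_neq0 i u c0_chamber.
case: ltgtP => // [uneg|upos] _.
  have [u' su uu'] := IH uneg; exists (rcons u' j); first by rewrite size_rcons.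
  by move=> x; rewrite !word_rcons uu'.
by exists u => // x; rewrite word_rcons (word_cross upos neg) sreflK.
Qed.

(** While some [a i] vanishes at [q] and is negative at [word w c], applying [s_i] fixes [q] and
    shortens [w]. Fixing every [z] that lies on all walls through [q], not only [q], is what later
    keeps the points chosen for smaller faces in place. *)
Lemma word_descend w q c :
  in_cchamber q -> in_cchamber c ->
  exists v, (forall z, in_cchamber z -> (forall j, a j q = 0 -> a j z = 0) ->
               word v z = z) /\
    exists2 t, 0 < t & in_cchamber (q + t *: word (v ++ w) c).
Proof.
move=> qC cC; have [k] := ubnP (size w); elim: k w => // k IH w sw.
have [/existsP[i /andP[/eqP qi wi]]|/existsPn good] :=
    boolP [exists i, (a i q == 0) && (a i (word w c) < 0)].
  (* Were [w c0] in front of the wall, [s_i w] would send [c0] behind it and [c] weakly behind it,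
     against the sign at [w c]. *)
  have ci : a i (word w c0) < 0.
    case: ltgtP (root_word_neq0 i w c0_chamber) => // wpos _.
    rewrite ltNge in wi; case/negP: wi.
    rewrite -oppr_le0 -root_srefl.
    by apply: (word_cchamber_le0 (w := i :: w)) cC;
       rewrite /= root_srefl oppr_lt0.
  have [w' sw' ww'] := word_exchange ci.
  have [|v [vfix [t t0 tv]]] := IH w'.
    by rewrite (leq_trans sw').
  exists (rcons v i); split.
    move=> z zC zq; rewrite word_rcons srefl_fixed; last exact: zq.
    exact: vfix.
  by exists t => //; rewrite cat_rcons word_cat /= ww' -word_cat.
exists [::]; split=> //.
have [t t0 ht] := small_perturbation (a^~ q) (a^~ (word w c)).
exists t => // i; rewrite linearD linearZ /=.
have := qC i; rewrite le_eqVlt => /orP[/eqP qi|/ht/ltW //].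
have := good i; rewrite -qi eqxx /= -leNgt => wi.
by rewrite add0r mulr_ge0 // ltW.
Qed.

End ReflectionWords.

(** * Relative interiors and faces of convex cones *)

Section Cones.
Variables (R : realType) (V : vectType R).
Implicit Types (K F Y : set V) (x y z : V).

(* For a convex cone, prolonging segments beyond [x], i.e. [x - e (y - x)] in [K],
   amounts to [x - e y] in [K]. *)
Definition rint K : set V :=
  [set x | K x /\ forall y, K y -> exists2 e : R, 0 < e & K (x - e *: y)].

Lemma cone_sum K n (x : 'I_n -> V) : convex_cone K -> K 0 ->
  (forall i, K (x i)) -> K (\sum_i x i).
Proof. by move=> [KD _] K0 Kx; elim/big_ind: _. Qed.

(** Vectors of [K] outside the current span are adjoined one by one; the codimension of the span,
    bounded by [k], drops each time. *)
Lemma cone_span K : exists (n : nat) (b : n.-tuple V),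
  (forall i : 'I_n, K b`_i) /\ forall x, K x -> x \in <<b>>%VS.
Proof.
suff [b [bK Kb]] : exists b : seq V,
    (forall x, x \in b -> K x) /\ forall x, K x -> x \in <<b>>%VS.
  by exists (size b), (in_tuple b); split=> // i; apply/bK/mem_nth.
suff H k (b : seq V) : (\dim {:V} - \dim <<b>> < k)%N ->
    (forall x, x \in b -> K x) -> exists b : seq V,
    (forall x, x \in b -> K x) /\ forall x, K x -> x \in <<b>>%VS.
  exact: (H _ [::] (ltnSn _)).
elim: k b => // k IH b bk bK.
have [Kb|/existsNP[x /not_implyP[Kx /negP xb]]] :=
    pselect (forall x, K x -> x \in <<b>>%VS); first by exists b.
apply: (IH (x :: b)); last by move=> y; rewrite inE => /predU1P[->|/bK].
have bxb : (<<b>> <= <<x :: b>>)%VS by rewrite span_cons addvSr.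
have : (\dim <<b>> < \dim <<x :: b>>)%N.
  rewrite (ltn_leqif (dimv_leqif_sup bxb)); apply: contra xb => xbb.
  by apply: (subvP xbb); rewrite memv_span // mem_head.
move=> bxb_dim; rewrite -ltnS (leq_trans _ bk) // ltnS ltn_sub2l //.
exact: leq_trans bxb_dim (dimvS (subvf _)).
Qed.

Lemma rint_nonempty K : convex_cone K -> K 0 -> rint K !=set0.
Proof.
move=> Kc K0; have [n [b [bK Kb]]] := cone_span K.
exists (\sum_(i < n) b`_i); split=> [|y /Kb yb]; first exact: cone_sum.
have [t t0 ht] := small_perturbation (fun=> 1) (fun i => - coord b i y).
exists t => //; rewrite {1}(coord_span yb) scaler_sumr -sumrB.
apply: cone_sum => // i; rewrite scalerA -{1}[b`_i]scale1r -scalerBl.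
by apply: Kc.2 => //; have := ht i ltr01; lra.
Qed.

Lemma rintD K x y : convex_cone K -> rint K x -> K y -> rint K (x + y).
Proof.
move=> [KD _] [Kx rx] Ky; split=> [|z /rx[e e0 Kz]]; first exact: KD.
by exists e => //; rewrite addrAC; apply: KD.
Qed.

Lemma rintZ K t x : convex_cone K -> 0 < t -> rint K x -> rint K (t *: x).
Proof.
move=> [_ KZ] t0 [Kx rx]; split=> [|z /rx[e e0 Kz]]; first exact: KZ.
exists (t * e); first exact: mulr_gt0.
by rewrite -scalerA -scalerBr; apply: KZ.
Qed.

Lemma rint_image K (g : {linear V -> V}) x :
  rint K x -> rint (g @` K) (g x).
Proof.
move=> [Kx rx]; split=> [|_ [z /rx[e e0 Kz] <-]]; first by exists x.
by exists e => //; exists (x - e *: z) => //; rewrite linearB linearZ.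
Qed.

Lemma face_zero Y F : face Y F -> Y 0 -> F !=set0 -> F 0.
Proof.
move=> [_ FY YF] Y0 [x Fx]; apply: contrapT => nF0.
have [_] : (Y `\` F) (0 + x).
  by apply: YF; exists 0 => //; exists x => //; exact: FY.
by rewrite add0r.
Qed.

Lemma face_split Y F x y : face Y F -> Y x -> Y y -> F (x + y) -> F x.
Proof.
move=> [_ _ YF] Yx Yy Fxy; apply: contrapT => nFx.
by have [] : (Y `\` F) (x + y) by apply: YF; exists x => //; exists y.
Qed.

(** Split [z] as [(z - e *: y) + e *: y] inside [F]: extremality of [F'] puts [e *: y], hence [y],
    into [F']. *)
Lemma face_rint_sub Y F F' z : face Y F -> face Y F' -> convex_cone Y ->
  rint F z -> F' z -> F `<=` F'.
Proof.
move=> [_ FY _] fF' Yc [Fz rz] F'z y Fy.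
have [e e0 Fzy] := rz _ Fy.
have F'ey : F' (e *: y).
  apply: (face_split (y := z - e *: y) fF'); last by rewrite addrC subrK.
    by apply: Yc.2 => //; exact: FY.
  exact: FY.
case: fF' => -[_ F'Z] _ _.
have := F'Z e^-1 _ _ F'ey; rewrite scalerA mulVf ?gt_eqF // scale1r.
by apply; rewrite invr_gt0.
Qed.

Lemma face_image Y F (g g' : {linear V -> V}) : cancel g g' -> cancel g' g ->
  (forall x, Y x -> Y (g x)) -> (forall x, Y x -> Y (g' x)) ->
  face Y F -> face Y (g @` F).
Proof.
move=> gK g'K gY g'Y [[FD FZ] FY YF]; split.
- split=> [_ _ [x Fx <-] [y Fy <-]|t _ t0 [x Fx <-]].
    by exists (x + y); [exact: FD|exact: linearD].
  by exists (t *: x); [exact: FZ|exact: linearZ].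
- by move=> _ [x /FY/gY ? <-].
- move=> _ [x [Yx nFx] [y Yy <-]].
  have [Yxy nFxy] : (Y `\` F) (g' x + g' y).
    apply: YF; exists (g' x); last by exists (g' y); [exact: g'Y|].
    by split; [exact: g'Y|apply: contra_not nFx => ?; exists (g' x)].
  split; first by rewrite -[x]g'K -[y]g'K -linearD; exact: gY.
  apply: contra_not nFxy => -[z Fz gz].
  by rewrite -linearD -gz gK.
Qed.

(** * Agreement of the algebraic and the topological relative interior *)

Lemma coord_continuous_r2v (n : nat) (b : n.-tuple V) (i : 'I_n) :
  continuous (fun u : 'rV[R]_(dim V) => coord b i (r2v u)).
Proof.
have E u : coord b i (r2v u) =
    \sum_j u ord0 j * coord b i (r2v (delta_mx ord0 j)).
  rewrite {1}[u]row_sum_delta linear_sum linear_sum; apply: eq_bigr => j _.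
  by rewrite linearZ linearZ.
rewrite (funext E); apply: continuous_big => [|j _ u]; first exact: add_continuous.
by apply: (@cvgMr_tmp _ _ (nbhs u)); exact: coord_continuous.
Qed.

Lemma rint_ri K : convex_cone K -> K 0 -> rint K `<=` ri K.
Proof.
move=> Kc K0 x [Kx rx]; split=> //.
have [n [b [bK Kb]]] := cone_span K.
have [e e0 Ke] := rx _ (cone_sum Kc K0 bK).
have near_c : \forall u \near v2r x,
    forall i, `|coord b i x - coord b i (r2v u)| < e.
  apply: (filter_forall (nbhs_filter (v2r x))) => i.
  have := @coord_continuous_r2v n b i (v2r x).
  by move=> /cvgrPdist_lt; rewrite v2rK; exact.
apply: filterS near_c => u uc [k [c [y [Ky _ uE]]]].
have ub : r2v u \in <<b>>%VS.
  by rewrite uE memv_suml // => i _; apply/memvZ/Kb/Ky.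
(* The first summand is in [K] by the choice of [e]; closeness of the coordinates makes every
   coefficient of the second positive. *)
have -> : r2v u = (x - e *: \sum_(i < n) b`_i) +
    \sum_(i < n) (e - (coord b i x - coord b i (r2v u))) *: b`_i.
  rewrite {1}(coord_span ub) {1}(coord_span (Kb x Kx)) scaler_sumr -sumrB.
  rewrite -big_split /=; apply: eq_bigr => i _.
  by rewrite -scalerBl -scalerDl; congr (_ *: _); lra.
apply: Kc.1 => //; apply: cone_sum => // i; apply: Kc.2 => //.
by have := uc i; have := ler_norm (coord b i x - coord b i (r2v u)); lra.
Qed.

Lemma ri_rint K : convex_cone K -> ri K `<=` rint K.
Proof.
move=> Kc x [Kx near_x]; split=> // y Ky.
(* The segment from [y] to [x] is prolonged beyond [x], inside the affine hull. *)
have : \forall e \near (0 : R),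
    affine_hull K (x + e *: (x - y)) -> K (x + e *: (x - y)).
  have : v2r x + e *: v2r (x - y) @[e --> (0 : R)] --> v2r x.
    rewrite -[X in _ --> X](addr0 (v2r x)) -(scale0r (v2r (x - y))).
    by apply: cvgD; [exact: cvg_cst|exact: scalel_continuous].
  move=> /(_ _ near_x) near0; apply: (@filterS _ (nbhs (0 : R)) _ _ _ _ near0) => e.
  by rewrite /= -linearZ -linearD v2rK.
move=> /nbhs_ballP[e /= e0 /(_ (e / 2))].
rewrite /ball /= => h.
have {h} : K (x + (e / 2) *: (x - y)).
  apply: h; first by rewrite sub0r normrN ger0_norm; lra.
  exists 2, (fun i => if i == ord0 then 1 + e / 2 else - (e / 2)),
    (fun i => if i == ord0 then x else y); split.
  - by move=> i; case: ifP.
  - by rewrite !big_ord_recl big_ord0 /=; lra.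
  - rewrite !big_ord_recl big_ord0 /= addr0 scalerDl scale1r scaleNr.
    by rewrite scalerBr addrA.
(* Dividing by [1 + e / 2] brings the coefficient of [x] back to 1, as [rint] demands. *)
have e1 : 0 < (1 + e / 2)^-1 by rewrite invr_gt0; lra.
move=> /(Kc.2 _ _ e1) Ke; exists ((1 + e / 2)^-1 * (e / 2)).
  by rewrite mulr_gt0 //; lra.
suff <- : (1 + e / 2)^-1 *: (x + (e / 2) *: (x - y)) =
  x - ((1 + e / 2)^-1 * (e / 2)) *: y by [].
rewrite scalerBr addrA -{1}[x]scale1r -scalerDl scalerBr !scalerA mulVf ?scale1r //.
by rewrite gt_eqF //; lra.
Qed.

End Cones.

(** * Group orbits of faces: uniqueness, then existence of representatives *)

Section FaceOrbits.
Variables (R : realType) (V : vectType R) (n : nat).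
Variables (a : 'I_n -> {scalar V}) (l : 'I_n -> V).
Hypothesis al : forall i, a i (l i) = 2.
Hypothesis disjoint_chambers : forall w c,
  in_chamber a c -> in_chamber a (word a l w c) -> word a l w =1 id.
Variable c0 : V.
Hypothesis c0_chamber : in_chamber a c0.
Variable p : 'I_n -> V.
Hypothesis p_wall : forall j, a j (p j) = 0.
Hypothesis p_pos : forall j k, k != j -> 0 < a k (p j).
Variable Y : set V.
Hypothesis Yc : convex_cone Y.
Hypothesis Y0 : Y 0.
Hypothesis Yinv : forall w x, Y x -> Y (word a l w x).

Lemma face_word w F : face Y F -> face Y (word a l w @` F).
Proof.
by apply: (face_image (word_revK al w) (word_revKV al w)) => x; exact: Yinv.
Qed.

(** [s_i] fixes [z], so the mirror image of [F] contains a relative interior point of [F] and thus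
    all of [F]; involutivity gives the converse. *)
Lemma face_srefl_fixed i F z : face Y F -> rint F z -> a i z = 0 ->
  srefl a l i @` F = F.
Proof.
move=> fF rz aiz; have fsF := face_word [:: i] fF.
have F_sub : F `<=` srefl a l i @` F.
  apply: (face_rint_sub fF fsF Yc rz).
  by exists z; [case: rz|rewrite /= srefl_fixed].
apply/seteqP; split=> // _ [x /F_sub[y Fy <-] <-].
by rewrite sreflK.
Qed.

Lemma face_orbit_unique w F x x' : face Y F -> face Y (word a l w @` F) ->
  rint F x -> in_cchamber a x ->
  rint (word a l w @` F) x' -> in_cchamber a x' -> word a l w @` F = F.
Proof.
move=> fF; have [k] := ubnP (size w); elim: k w x' => // k IH [|i w] x' sw.
  by move=> *; apply/seteqP; split=> [_ [y Fy <-] //|y Fy]; exists y.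
move=> fwF rx xC rx' x'C.
(* By induction it suffices to obtain the same image from a word no longer than the tail [w]. *)
have shorten w' : (size w' <= size w)%N ->
    word a l (i :: w) @` F = word a l w' @` F -> word a l (i :: w) @` F = F.
  move=> sw' ww'; rewrite ww' in fwF rx' *.
  exact: (IH w' x' (leq_ltn_trans sw' sw)).
case: (ltgtP (a i (word a l w c0)) 0)
    (root_word_neq0 al disjoint_chambers i w c0_chamber)
  => // [wneg|wpos] _.
  have [w' sw' ww'] :=
    word_exchange al disjoint_chambers c0_chamber p_wall p_pos wneg.
  by apply: (shorten w' (ltnW sw')); apply: eq_imagel => y _; rewrite -ww'.
apply: (shorten w (leqnn _)).
have wneg : a i (word a l (i :: w) c0) < 0 by rewrite /= root_srefl // oppr_lt0.
have wx : a i (word a l (i :: w) x) <= 0.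
  exact: (word_cchamber_le0 al disjoint_chambers c0_chamber wneg xC).
have rwx := rint_image (word a l (i :: w)) rx.
have cF : convex_cone (word a l (i :: w) @` F) by case: fwF.
(* The relative interior of [s_i w F] contains [x'], weakly in front of the i-th wall, and the image
   of [x], weakly behind it; one of them or a positive combination of both is on the wall. *)
have [z rz aiz] : exists2 z, rint (word a l (i :: w) @` F) z & a i z = 0.
  have := x'C i; rewrite le_eqVlt => /orP[/eqP x'0|x'pos]; first by exists x'.
  move: wx; rewrite le_eqVlt => /orP[/eqP wx0|wxneg].
    by exists (word a l (i :: w) x).
  exists ((- a i (word a l (i :: w) x)) *: x' +
          a i x' *: word a l (i :: w) x).
    apply: rintD => //; first by apply: rintZ => //; rewrite oppr_gt0.
    by apply: cF.2 => //; case: rwx.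
  by rewrite linearD linearZ linearZ /=; lra.
rewrite -(face_srefl_fixed fwF rz aiz) image_comp.
by apply: eq_imagel => y _ /=; rewrite sreflK.
Qed.

Hypothesis Ysub : forall y, Y y ->
  exists w c, in_cchamber a c /\ y = word a l w c.

Lemma chain_to_cchamber m (F : 'I_m -> set V) : (forall i, Fa Y (F i)) ->
  is_chain F -> forall k, exists w (z : 'I_m -> V), forall i : 'I_m, (i < k)%N ->
    rint (word a l w @` F i) (z i) /\ in_cchamber a (z i).
Proof.
move=> FY Fchain; elim=> [|k [w [z zP]]]; first by exists [::], (fun=> 0).
have [mk|km] := leqP m k.
  by exists w, z => i _; apply: zP; exact: leq_trans (ltn_ord i) mk.
(* [q] collects the points placed so far (0 if there are none); since the chain increases, it lies
   in the translate of the next face. *)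
pose j := Ordinal km; pose q := \sum_(i < m | (i < k)%N) z i.
have cFw i : convex_cone (word a l w @` F i).
  by have [/(face_word w)[]] := FY i.
have F0 i : F i 0 by have [fFi] := FY i; exact: (face_zero fFi).
have qF : (word a l w @` F j) q.
  rewrite /q; elim/big_ind: _ => [||i ik]; first by exists 0; rewrite ?linear0.
    exact: (cFw j).1.
  have [[[y Fy <-] _] _] := zP i ik; exists y => //.
  by apply: (Fchain i j) Fy; exact: ltnW.
have qE i : a i q = \sum_(i' < m | (i' < k)%N) a i (z i') by exact: linear_sum.
have qC : in_cchamber a q.
  by move=> i; rewrite qE; apply: sumr_ge0 => i' /zP[_]; exact.
have [[fFj _ _] _] := FY j; have [y0 ry0] := rint_nonempty fFj (F0 j).
have Yy0 : Y y0 by have [[_ FjY _] _] := FY j; apply: FjY; case: ry0.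
have [u [c [cC uc]]] := Ysub (Yinv w Yy0).
have [v [vfix [t t0 tv]]] :=
  word_descend al disjoint_chambers c0_chamber p_wall p_pos u qC cC.
have vw i : word a l (v ++ w) @` F i = word a l v @` (word a l w @` F i).
  by rewrite image_comp; apply: eq_imagel => y _; rewrite word_cat.
(* Earlier points stay, being fixed by [v]. The new one is [v] applied to [q + t *: word u c], as
   [v] fixes [q] too; values at indices beyond [j] do not matter. *)
exists (v ++ w), (fun i : 'I_m =>
  if (i < k)%N then z i else q + t *: word a l (v ++ u) c) => i.
rewrite ltnS; case: ifP => [ik _|/negbT]; last first.
  rewrite -leqNgt => ki ik; have -> : i = j by apply/val_inj/eqP; rewrite eqn_leq ik.
  split=> //; rewrite vw addrC; apply: rintD.
  - by have [/(face_word w)/(face_word v)[]] := FY j.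
  - apply: rintZ => //; first by have [/(face_word w)/(face_word v)[]] := FY j.
    by rewrite word_cat -uc; do 2 apply: rint_image.
  - by exists q => //; exact: vfix.
have [rz zC] := zP i ik; split=> //; rewrite vw.
have <- : word a l v (z i) = z i; last exact: rint_image.
(* A vanishing sum of nonnegative terms: every wall containing [q] contains [z i]. *)
apply: vfix => // i'; rewrite qE => /eqP;
  rewrite psumr_eq0 => [/allP|j' /zP[_]]; last exact.
by move=> /(_ i); rewrite mem_index_enum ik => /(_ isT)/eqP.
Qed.

End FaceOrbits.

(** * From a linear Coxeter system to linear forms, reflection vectors and words *)

Section CoxeterSystem.
Variables (R : realType) (h : vectType R).
Notation hdual := 'Hom(h, R^o).

Definition ev (v : h) (f : hdual) : R := f v.

Lemma ev_is_scalar v : scalar (ev v).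
Proof. by move=> t f g; rewrite /ev add_lfunE scale_lfunE. Qed.
HB.instance Definition _ v := GRing.isLinear.Build R hdual R *%R (ev v)
  (ev_is_scalar v).

Variables (n : nat) (H : 'I_n -> set h) (L : 'I_n -> set hdual).
Hypothesis HL : linear_coxeter_system H L.

Lemma coxeter_roots : exists (v : 'I_n -> h) (l : 'I_n -> hdual),
  [/\ forall i, H i = [set t *: v i | t in [set t : R | 0 <= t]],
      forall i, L i = [set t *: l i | t in [set t : R | 0 <= t]] &
      forall i, ev (v i) (l i) = 2].
Proof.
have /choice[v vP] i :
    exists v, v != 0 /\ H i = [set t *: v | t in [set t : R | 0 <= t]].
  by have [v v0 ->] := lcs_ray HL i; exists v.
have /choice[l lP] i : exists l,
    L i = [set t *: l | t in [set t : R | 0 <= t]] /\ ev (v i) l = 2.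
  have [l l0 LE] := lcs_coray HL i; have [v0 HE] := vP i.
  have lpos : 0 < ev (v i) l.
    apply: (lcs_pos HL (i := i)).
      split; last exact/eqP.
      by rewrite LE; exists 1 => /=; rewrite ?scale1r.
    by split; [rewrite HE; exists 1 => /=; rewrite ?scale1r|exact/eqP].
  (* The pairing is positive by the axiom on [L i], so the generator can be rescaled to the
     normalization of a reflection. *)
  pose r := 2 / ev (v i) l; have r0 : 0 < r by rewrite divr_gt0.
  exists (r *: l); split; last by rewrite linearZ /= divfK // gt_eqF.
  rewrite LE; apply/seteqP; split=> _ [t /= t0 <-].
    exists (t / r); first by rewrite /= divr_ge0 // ltW.
    by rewrite scalerA divfK // gt_eqF.
  by exists (t * r); [rewrite /= mulr_ge0 // ltW|rewrite scalerA].
by exists v, l; split=> i; [case: (vP i)|case: (lP i)..].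
Qed.

Variables (v : 'I_n -> h) (l : 'I_n -> hdual).
Hypothesis HE : forall i, H i = [set t *: v i | t in [set t : R | 0 <= t]].
Hypothesis LE : forall i, L i = [set t *: l i | t in [set t : R | 0 <= t]].
Hypothesis al : forall i, ev (v i) (l i) = 2.
Local Notation a := (fun i => ev (v i) : {scalar hdual}).

Lemma v_neq0 i : v i != 0.
Proof.
apply/eqP => vi0; have := al i; rewrite /ev vi0 linear0 => /esym/eqP.
by rewrite pnatr_eq0.
Qed.

Lemma closed_chamberE x : closed_chamber H x <-> in_cchamber a x.
Proof.
split=> [xC i|xC i _ y]; last first.
  by rewrite HE => -[t /= t0 <-]; rewrite linearZ mulr_ge0 //; exact: xC.
by apply: (xC i I); rewrite HE; exists 1 => /=; rewrite ?scale1r.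
Qed.

Lemma open_chamberE x : open_chamber H x <-> in_chamber a x.
Proof.
split=> [xC i|xC i _ y].
  apply: (xC i I); split; last exact/eqP/v_neq0.
  by rewrite HE; exists 1 => /=; rewrite ?scale1r.
rewrite HE => -[[t /= t0 <-] /eqP]; rewrite scaler_eq0 negb_or => /andP[tn0 _].
by rewrite linearZ; apply: mulr_gt0; [rewrite lt_def tn0|exact: xC].
Qed.

Lemma ray_eq0E i x : ray_eq0 (H i) x <-> ev (v i) x = 0.
Proof.
split=> [xH|xv y].
  by apply: xH; rewrite HE; exists 1 => /=; rewrite ?scale1r.
rewrite HE => -[t /= t0 <-]; rewrite linearZ /=.
by rewrite [x (v i)]xv scaler0.
Qed.

Lemma reflection_atE i (s : 'End(hdual)) :
  reflection_at H L i s <-> s =1 srefl a l i.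
Proof.
split=> [[sH sL] x|sE].
  have sl : s (l i) = - l i.
    by apply: sL; left; rewrite LE; exists 1 => /=; rewrite ?scale1r.
  pose y := x - (ev (v i) x / 2) *: l i.
  have sy : s y = y.
    by apply/sH/ray_eq0E; rewrite linearB linearZ /= al divfK ?pnatr_eq0 // subrr.
  have -> : s x = s y + (ev (v i) x / 2) *: s (l i).
    by rewrite -linearZ -linearD subrK.
  rewrite sy sl /srefl /y scalerN -addrA -opprD -scalerDl.
  by rewrite -splitr.
split=> [x /ray_eq0E aix|]; first by rewrite sE srefl_fixed.
have sl t : srefl a l i (t *: l i) = - (t *: l i).
  have -> : - (t *: l i) = t *: l i - (t * 2) *: l i.
    by rewrite -scalerBl -scaleNr; congr (_ *: _); lra.
  by rewrite -(al i) /srefl /= [ev (v i) (t *: l i)]linearZ.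
move=> x [|[y]]; rewrite LE => -[t _ <-]; first by rewrite sE sl.
by move=> <-; rewrite sE -scaleNr sl.
Qed.

Lemma coxeter_groupE (s : 'End(hdual)) :
  coxeter_group H L s <-> exists w, s =1 word a l w.
Proof.
split=> [sG|[w sw]].
  apply: (sG [set t : 'End(hdual) | exists w, t =1 word a l w]).
  split=> [|t [i /reflection_atE ti]]; last by exists [:: i].
  split; first by exists [::] => x; rewrite id_lfunE.
    move=> f g [w1 fE] [w2 gE]; exists (w1 ++ w2) => x.
    by rewrite comp_lfunE fE gE word_cat.
  move=> f [w fE]; exists (rev w) => x.
  (* Injectivity makes [(f^-1)%VF] a genuine inverse, given by the reversed word. *)
  have f_ker : lker f == 0%VS.
    by apply/lker0P => y z; rewrite !fE => /(can_inj (word_revK al w)).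
  by rewrite -{1}[x](word_revKV al w) -fE lker0_lfunK.
move=> M /= [[M1 MM _] MR]; have {sw} -> : s = linfun (word a l w).
  by apply/lfunP => x; rewrite lfunE sw.
elim: w => [|i w IH].
  have -> // : linfun (word a l [::]) = \1%VF.
  by apply/lfunP => x; rewrite !id_lfunE.
have -> : linfun (word a l (i :: w)) =
    (linfun (srefl a l i) \o linfun (word a l w))%VF.
  by apply/lfunP => x; rewrite comp_lfunE !lfunE.
by apply: MM => //; apply: MR; exists i; apply/reflection_atE => x; rewrite lfunE.
Qed.

Lemma coxeter_disjoint w c :
  in_chamber a c -> in_chamber a (word a l w c) -> word a l w =1 id.
Proof.
move=> cC wcC x; pose s := linfun (word a l w).
have [s1|s1] := pselect (s = \1%VF).
  by rewrite -[LHS](lfunE (word a l w)) -/s s1 id_lfunE.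
have sW : coxeter_group H L s by apply/coxeter_groupE; exists w; exact: lfunE.
have : (s @` open_chamber H `&` open_chamber H) (word a l w c).
  split; last exact/open_chamberE.
  by exists c; [exact/open_chamberE|exact: lfunE].
by rewrite (lcs_disj HL sW s1).
Qed.

Definition root_ker i : {vspace hdual} := lker (linfun (ev (v i) : hdual -> R^o)).

Lemma root_kerE i x : (x \in root_ker i) = (ev (v i) x == 0).
Proof. by rewrite memv_ker lfunE. Qed.

(** The closed chamber spans, so no hyperplane [a i = 0] contains it; summing one point off each
    hyperplane gives a point off all of them. *)
Lemma in_chamber_exists : exists c, in_chamber a c.
Proof.
have /choice[c cP] i : exists c, in_cchamber a c /\ 0 < ev (v i) c.
  apply: contrapT => noc; have [_ /(_ (root_ker i))] := lcs_span HL.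
  move=> Cker; have : l i \in root_ker i.
    apply: (subvP (Cker _)) (memvf _) => x /closed_chamberE xC.
    rewrite root_kerE eq_le xC andbT leNgt; apply/negP => xpos.
    by apply: noc; exists x.
  by rewrite root_kerE al pnatr_eq0.
exists (\sum_i c i) => i; rewrite linear_sum (bigD1 i) //=.
rewrite ltr_wpDr //; last by case: (cP i).
by apply: sumr_ge0 => j _; have [cC _] := cP j; exact: cC.
Qed.

(** Otherwise [a k] vanishes on the j-th wall, whose span is a hyperplane; then [a j] and [a k] have
    the same kernel, and the two walls coincide. *)
Lemma wall_separate j k : k != j ->
  exists x, [/\ in_cchamber a x, ev (v j) x = 0 & 0 < ev (v k) x].
Proof.
move=> kj; apply: contrapT => nox.
have wallE i x : wall H i x <-> in_cchamber a x /\ ev (v i) x = 0.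
  by split=> -[/closed_chamberE xC /ray_eq0E xi].
have : range (wall H) (wall H j) by exists j.
rewrite (lcs_walls HL) => -[_ [UK [UF [[KU _] [FU minUF] dimU]]]].
have UKf : UK = fullv.
  apply/eqP; rewrite eqEsubv subvf /=; exact: (lcs_span HL).2.
(* The span [UF] has codimension 1 and lies in the kernel, which is proper because it misses
   [l i]. *)
have UF_ker i : (forall x, wall H j x -> ev (v i) x = 0) -> UF = root_ker i.
  move=> ji; apply/eqP; rewrite eqEdim minUF; last first.
    by move=> x /ji/eqP; rewrite root_kerE.
  have kerUK : (root_ker i <= UK)%VS by rewrite UKf subvf.
  rewrite -ltnS -dimU (ltn_leqif (dimv_leqif_sup kerUK)).
  apply/negP => /subvP /(_ (l i)).
  by rewrite UKf memvf root_kerE al pnatr_eq0 => /(_ isT).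
have kerE : root_ker j = root_ker k.
  rewrite -UF_ker => [|x /wallE[] //]; rewrite -UF_ker // => x /wallE[xC xj].
  apply/eqP; rewrite eq_le xC andbT leNgt; apply/negP => xk.
  by apply: nox; exists x.
have kerP x : ev (v j) x = 0 <-> ev (v k) x = 0.
  by split=> /eqP xi; apply/eqP; move: xi; rewrite -!root_kerE kerE.
case/eqP: kj; apply: (lcs_wall_inj HL).
by apply/seteqP; split=> x /wallE[xC /kerP xi]; apply/wallE.
Qed.

Lemma wall_points : exists p : 'I_n -> hdual,
  (forall j, ev (v j) (p j) = 0) /\ forall j k, k != j -> 0 < ev (v k) (p j).
Proof.
have /choice[q qP] (jk : 'I_n * 'I_n) : exists x, [/\ in_cchamber a x,
    ev (v jk.1) x = 0 & jk.2 != jk.1 -> 0 < ev (v jk.2) x].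
  have [_|/wall_separate[x [xC xj xk]]] := eqVneq jk.2 jk.1; last by exists x.
  by exists 0; split=> [i||//]; rewrite linear0.
exists (fun j => \sum_k q (j, k)); split=> [j|j k kj].
  by rewrite linear_sum big1 // => k _; case: (qP (j, k)).
rewrite linear_sum (bigD1 k) //= ltr_wpDr //; last by case: (qP (j, k)) => _ _; exact.
by apply: sumr_ge0 => k' _; have [qC _ _] := qP (j, k'); exact: qC.
Qed.

End CoxeterSystem.

(** * Existence and uniqueness of the chain in [Upsilon] *)

Theorem theorem4p11 (R : realType) (h : vectType R) (n : nat)
    (H : 'I_n -> set h) (L : 'I_n -> set 'Hom(h, R^o))
    (HL : linear_coxeter_system H L)
    (Y : set 'Hom(h, R^o))
    (Ysub : Y `<=` tits_cone H L)
    (Ycone : convex_cone Y)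
    (Y0 : Y 0)
    (Yinv : forall s, coxeter_group H L s -> s @` Y `<=` Y)
    (m : nat) (F : 'I_m -> set 'Hom(h, R^o))
    (FY : forall i, Fa Y (F i))
    (Fchain : is_chain F) :
  exists! S : 'I_m -> set 'Hom(h, R^o),
    [/\ is_chain S,
        forall i, Upsilon H Y (S i) &
        exists2 s, coxeter_group H L s & forall i, F i = s @` S i].
Proof.
have [v [l [HE LE al]]] := coxeter_roots HL.
pose a i : {scalar 'Hom(h, R^o)} := ev (v i).
have disj := coxeter_disjoint HL HE LE al.
have [c0 c0C] := in_chamber_exists HL HE al.
have [p [p_wall p_pos]] := wall_points HL HE al.
have wW w : coxeter_group H L (linfun (word a l w)).
  by apply/(coxeter_groupE HE LE al); exists w; exact: lfunE.
have wY w x : Y x -> Y (word a l w x).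
  by move=> Yx; apply: (Yinv _ (wW w)); exists x; rewrite ?lfunE.
have Ytits y : Y y -> exists w c, in_cchamber a c /\ y = word a l w c.
  move=> /Ysub[s /(coxeter_groupE HE LE al)[w sw] [c /(closed_chamberE HE) cC <-]].
  by exists w, c; split; [exact: cC|exact: sw].
have [w [z zP]] :=
  chain_to_cchamber al disj c0C p_wall p_pos Y0 wY Ytits FY Fchain m.
have fwF i : face Y (word a l w @` F i) by have [] := FY i => /(face_word al wY w).
have Fa_cone G : Fa Y G -> convex_cone G /\ G 0.
  by move=> [fG G0]; split; [case: fG|exact: (face_zero fG)].
have wF0 i : (word a l w @` F i) 0.
  by exists 0; [case: (Fa_cone _ (FY i))|exact: linear0].
exists (fun i => word a l w @` F i); split.
  split.
  - by move=> i j ij _ [x /(Fchain _ _ ij) Fx <-]; exists x.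
  - move=> i; split; first by split=> //; exists 0.
    have [rz zC] := zP i (ltn_ord i); exists (z i); split; last exact/closed_chamberE.
    by apply: rint_ri => //; case: (fwF i).
  (* The word [w] moved the chain to the closed chamber; its reverse moves it back. *)
  - exists (linfun (word a l (rev w))) => // i; rewrite image_comp.
    rewrite -[LHS]image_id; apply: eq_imagel => x _ /=.
    by rewrite lfunE /= word_revK.
move=> S [_ SU [s /(coxeter_groupE HE LE al)[w' sw'] FS]].
apply/funext => i.
(* [S i] and [word w] of [F i] are in one orbit and both have relative interiors meeting the closed
   chamber, so they are equal, whatever group element accompanies [S]. *)
have wFS : word a l w @` F i = word a l (w ++ w') @` S i.
  by rewrite FS image_comp; apply: eq_imagel => x _ /=; rewrite sw' word_cat.
have [FaS [x [rx /(closed_chamberE HE) xC]]] := SU i.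
have [cS S0] := Fa_cone _ FaS.
have [rz zC] := zP i (ltn_ord i).
have := fwF i; rewrite wFS in rz * => fwS.
apply: (face_orbit_unique al disj c0C p_wall p_pos Ycone wY _ fwS _ xC rz zC).
  by case: FaS.
exact: ri_rint.
Qed.
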